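(* A universe of separations $\vec U$ can be strongly implemented by set separations if and only if it is distributive and scrupulous.
   Context: A separation system is a poset with an order-reversing involution $\vec s\mapsto\vec s^{\,*}$; a universe of separations is a separation system which is a lattice, with join $\vee$ and meet $\wedge$. $\vec U$ is distributive if this lattice is distributive. An element $\vec s$ is small if $\vec s\le\vec s^{\,*}$; $\vec U$ is scrupulous if $\vec r\le\vec s^{\,*}$ for all small $\vec r,\vec s\in\vec U$. A homomorphism of universes is a map commuting with the involutions, joins and meets; an isomorphism of universes is a bijective homomorphism whose inverse is a homomorphism. For a set $V$, $\mathcal{U}(V)$ is the universe of all pairs $(A,B)$ of subsets of $V$ with $A\cup B=V$, with involution $(A,B)^*=(B,A)$, order $(A,B)\le(C,D)$ iff $A\subseteq C$ and $D\subseteq B$, join $(A,B)\vee(C,D)=(A\cup C,B\cap D)$ and meet $(A,B)\wedge(C,D)=(A\cap C,B\cup D)$. A sub-universe is a subset closed under involution, join and meet. $\vec U$ can be strongly implemented by set separations if there are a set $V$ and a sub-universe of $\mathcal{U}(V)$ isomorphic (as a universe) to $\vec U$. *)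

(* Defs.v *)
From HB Require Import structures.
From mathcomp Require Import all_boot all_order.
From mathcomp Require Import boolp classical_sets.

Set Implicit Arguments.
Unset Strict Implicit.
Unset Printing Implicit Defensive.

Import Order.TTheory.
Local Open Scope order_scope.

(* The boolean order and choice operator carried by MathComp's order structures
   are no restriction: classically every poset and every lattice has them. *)
HB.mixin Record hasInvolution d T of Order.POrder d T := {
  star : T -> T;
  starK : involutive star;
  le_star : forall x y : T, x <= y -> star y <= star x
}.

#[short(type="sepSystemType")]
HB.structure Definition SepSystem d :=
  { T of Order.POrder d T & hasInvolution d T }.

#[short(type="universeType")]
HB.structure Definition Universe d :=
  { T of Order.Lattice d T & hasInvolution d T }.

Definition distributive_universe {d : Order.disp_t} (U : universeType d) : Prop :=
  left_distributive (@Order.meet d U) (@Order.join d U).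

Definition small {d : Order.disp_t} {U : universeType d} (s : U) : Prop := s <= star s.

Definition scrupulous {d : Order.disp_t} (U : universeType d) : Prop :=
  forall r s : U, small r -> small s -> r <= star s.

Definition universe_hom {d d' : Order.disp_t} {U : universeType d}
    {U' : universeType d'} (f : U -> U') : Prop :=
  [/\ {morph f : x / star x >-> star x},
      {morph f : x y / x `|` y >-> x `|` y} &
      {morph f : x y / x `&` y >-> x `&` y}].

Definition universe_iso {d d' : Order.disp_t} {U : universeType d}
    {U' : universeType d'} (f : U -> U') : Prop :=
  universe_hom f /\
  exists g : U' -> U, [/\ cancel f g, cancel g f & universe_hom g].

Definition isomorphic_universes {d d' : Order.disp_t}
    (U : universeType d) (U' : universeType d') : Prop :=
  exists f : U -> U', universe_iso f.

Fact setsep_display : Order.disp_t. Proof. exact: Order.Disp tt tt. Qed.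

Record setsep (V : Type) := SetSep {
  lside : set V;
  rside : set V;
  setsep_cover : (lside `|` rside)%classic = [set: V]%classic
}.

Section SetSeparations.
Context {V : Type}.
Implicit Types s t u : setsep V.

HB.instance Definition _ := gen_eqMixin (setsep V).
HB.instance Definition _ := gen_choiceMixin (setsep V).

Lemma setsep_eqP s t : lside s = lside t -> rside s = rside t -> s = t.
Proof.
case: s t => [A B AB] [C D CD] /= eqAC eqBD; move: CD; rewrite -eqAC -eqBD => CD.
by congr SetSep; exact: Prop_irrelevance.
Qed.

Lemma setsep_join_subproof s t :
  ((lside s `|` lside t) `|` (rside s `&` rside t))%classic = [set: V]%classic.
Proof.
apply/seteqP; split=> // x _.
have := setsep_cover s; have := setsep_cover t => /seteqP[_ /(_ x I)] ht.
move=> /seteqP[_ /(_ x I)]; case=> hs; first by left; left.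
by case: ht => ht; [left; right|right].
Qed.

Lemma setsep_meet_subproof s t :
  ((lside s `&` lside t) `|` (rside s `|` rside t))%classic = [set: V]%classic.
Proof.
apply/seteqP; split=> // x _.
have := setsep_cover s; have := setsep_cover t => /seteqP[_ /(_ x I)] ht.
move=> /seteqP[_ /(_ x I)]; case=> hs; last by right; left.
by case: ht => ht; [left|right; right].
Qed.

Lemma setsep_star_subproof s : (rside s `|` lside s)%classic = [set: V]%classic.
Proof. by rewrite setUC setsep_cover. Qed.

Definition setsep_le s t : bool :=
  `[< (lside s `<=` lside t)%classic /\ (rside t `<=` rside s)%classic >].
Definition setsep_join s t : setsep V := SetSep (setsep_join_subproof s t).
Definition setsep_meet s t : setsep V := SetSep (setsep_meet_subproof s t).
Definition setsep_star s : setsep V := SetSep (setsep_star_subproof s).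

Lemma setsep_leP s t :
  reflect ((lside s `<=` lside t)%classic /\ (rside t `<=` rside s)%classic)
    (setsep_le s t).
Proof. exact: asboolP. Qed.

Fact setsep_le_refl : reflexive setsep_le.
Proof. by move=> s; apply/setsep_leP; split. Qed.

Fact setsep_le_anti : antisymmetric setsep_le.
Proof.
move=> s t /andP[/setsep_leP[a b] /setsep_leP[c e]].
by apply: setsep_eqP; apply/seteqP.
Qed.

Fact setsep_le_trans : transitive setsep_le.
Proof.
move=> t s u /setsep_leP[a b] /setsep_leP[c e].
by apply/setsep_leP; split; [exact: subset_trans c|exact: subset_trans b].
Qed.

HB.instance Definition _ := Order.Le_isPOrder.Build setsep_display (setsep V)
  setsep_le_refl setsep_le_anti setsep_le_trans.

Fact setsep_meetP s t u : (s <= setsep_meet t u) = (s <= t) && (s <= u).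
Proof.
apply/setsep_leP/andP => /=; rewrite subsetI subUset.
  by move=> [[a b] [c e]]; split; apply/setsep_leP.
by move=> [/setsep_leP[a b] /setsep_leP[c e]].
Qed.

Fact setsep_joinP s t u : (setsep_join s t <= u) = (s <= u) && (t <= u).
Proof.
apply/setsep_leP/andP => /=; rewrite subsetI subUset.
  by move=> [[a b] [c e]]; split; apply/setsep_leP.
by move=> [/setsep_leP[a b] /setsep_leP[c e]].
Qed.

HB.instance Definition _ := Order.POrder_MeetJoin_isLattice.Build
  setsep_display (setsep V) setsep_meetP setsep_joinP.

Fact setsep_starK : involutive setsep_star.
Proof. by move=> s; apply: setsep_eqP. Qed.

Fact setsep_le_star s t : s <= t -> setsep_star t <= setsep_star s.
Proof. by move=> /setsep_leP[a b]; apply/setsep_leP. Qed.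

HB.instance Definition _ :=
  hasInvolution.Build setsep_display (setsep V) setsep_starK setsep_le_star.

End SetSeparations.

HB.mixin Record isStarClosed d (U : universeType d) (S : {pred U}) := {
  star_closed : forall x : U, x \in S -> star x \in S
}.

#[short(type="subUniverse")]
HB.structure Definition SubUniverse d (U : universeType d) :=
  { S of Order.isMeetLatticeClosed d U S & Order.isJoinLatticeClosed d U S
       & isStarClosed d U S }.

(* The elements of S, made below into a universe with the structure inherited
   from U. *)
Record subuniverse_sort {d : Order.disp_t} {U : universeType d}
    (S : subUniverse U) := SubUniverseElt {
  subuniverse_val : U;
  subuniverse_valP : subuniverse_val \in S
}.

Section SubUniverseStructure.
Context {d : Order.disp_t} {U : universeType d} (S : subUniverse U).
Local Notation T := (subuniverse_sort S).

HB.instance Definition _ := [isSub of T for @subuniverse_val d U S].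
HB.instance Definition _ := [Choice of T by <:].
HB.instance Definition _ := [SubChoice_isSubLattice of T by <: with d].

Definition sub_star (x : T) : T :=
  SubUniverseElt (star_closed _ (subuniverse_valP x)).

Fact sub_starK : involutive sub_star.
Proof. by move=> x; apply: val_inj; rewrite /= starK. Qed.

Fact sub_le_star (x y : T) : x <= y -> sub_star y <= sub_star x.
Proof. by rewrite -!Order.le_val /=; exact: le_star. Qed.

HB.instance Definition _ :=
  hasInvolution.Build _ T sub_starK sub_le_star.

End SubUniverseStructure.

Definition strongly_implementable {d : Order.disp_t}
    (U : universeType d) : Prop :=
  exists (V : Type) (S : subUniverse (setsep V)),
    isomorphic_universes U (subuniverse_sort S).

(* Main.v *)
Require Import Defs.
From HB Require Import structures.
From mathcomp Require Import all_boot all_order.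
From mathcomp Require Import boolp classical_sets.

(** A universe of set separations inherits distributivity from the powerset
    lattice, and its small elements are the pairs (A, V), whence scrupulousness.

    Conversely, let V be the set of prime filters P of U such that, for every
    s, P contains s or its inverse, and send s to the pair of {P | s in P} and
    {P | s^* in P}.  This is a homomorphism into U(V); the point is that it is
    injective.  A prime filter belongs to V as soon as it contains all co-small
    elements, i.e. those c with c^* <= c.  By scrupulousness these are closed
    under meets.  So, by the prime filter theorem, some point of V contains s
    but not t unless s `&` c <= t for some co-small c; likewise, some point
    contains t^* but not s^* unless s <= t `|` r for some small r.  If both
    exceptions occur then, since r <= c by scrupulousness,
    s <= (s `&` t) `|` (s `&` r) <= t `|` (s `&` c) <= t. *)

Set Implicit Arguments.
Unset Strict Implicit.
Unset Printing Implicit Defensive.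

Import Order.TTheory.
Local Open Scope order_scope.

(** * De Morgan laws and small elements *)

Section StarTheory.
Context {d : Order.disp_t} {U : universeType d}.
Implicit Types x y : U.

Lemma le_star2 x y : (star x <= star y) = (y <= x).
Proof.
by apply/idP/idP => /le_star //; rewrite !starK.
Qed.

Lemma starI x y : star (x `&` y) = star x `|` star y.
Proof.
apply/le_anti/andP; split; last by rewrite leUx !le_star2 leIl leIr.
rewrite -le_star2 starK lexI -[_ <= x]le_star2 -[_ <= y]le_star2 starK.
by rewrite leUl leUr.
Qed.

Lemma starU x y : star (x `|` y) = star x `&` star y.
Proof. by rewrite -[RHS]starK starI !starK. Qed.

Lemma small_meet_star x : small (x `&` star x).
Proof. by rewrite /small starI starK (le_trans (leIl _ _)) ?leUr. Qed.

(** The star of the join is the meet of [star x] and [star y]; by scrupulousness both [x] and [y]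
    lie below each of these. *)
Lemma small_join x y : scrupulous U -> small x -> small y -> small (x `|` y).
Proof. by move=> scrU sx sy; rewrite /small starU leUx !lexI !scrU. Qed.

End StarTheory.

(** * The prime filter theorem for distributive lattices *)

Section PrimeFilters.
Context {d : Order.disp_t} {L : latticeType d}.
Implicit Types (P F : set L) (s t x y : L).

Definition lattice_filter P :=
  (forall x y, x <= y -> P x -> P y) /\
  (forall x y, P x -> P y -> P (x `&` y)).

Definition prime_filter P :=
  lattice_filter P /\ forall x y, P (x `|` y) -> P x \/ P y.

Lemma prime_filterI P x y : prime_filter P -> P (x `&` y) = (P x /\ P y).
Proof.
move=> [[upP capP] _]; apply/propext; split=> [Pxy|[]]; last exact: capP.
by split; apply: upP Pxy; [exact: leIl|exact: leIr].
Qed.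

Lemma prime_filterU P x y : prime_filter P -> P (x `|` y) = (P x \/ P y).
Proof.
move=> [[upP _] primeP]; apply/propext; split; first exact: primeP.
by case; apply: upP; [exact: leUl|exact: leUr].
Qed.

Context (distrL : left_distributive (@Order.meet d L) (@Order.join d L)).

(** Zorn's lemma gives a maximal filter among those containing [F] and avoiding [t]; distributivity
    makes it prime. *)
Lemma prime_filter_theorem F t : lattice_filter F -> (F !=set0)%classic ->
  ~ F t -> exists P, [/\ prime_filter P, (F `<=` P)%classic & ~ P t].
Proof.
move=> filF [f Ff] Ft.
pose avoids P := lattice_filter P /\ ~ P t.
(* Taking the union with F makes the empty chain harmless in Zorn's lemma. *)
have [|P [[[upP capP] Pt] maxP]] :=
  @Zorn_bigcup L (fun P => avoids (F `|` P)%classic).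
  move=> C subC totC; split; last first.
    by case=> // -[Q /subC[_ FQt] Qt]; apply: FQt; right.
  split=> x y.
    move=> lexy [Fx|[Q CQ Qx]]; first by left; apply: filF.1 Fx.
    have [[upQ _] _] := subC _ CQ.
    by case: (upQ x y lexy (or_intror Qx)) => ?; [left|right; exists Q].
  have step Q : C Q -> (F `|` Q)%classic x -> (F `|` Q)%classic y ->
      (F `|` \bigcup_(X in C) X)%classic (x `&` y).
    move=> CQ FQx FQy; have [[_ capQ] _] := subC _ CQ.
    by case: (capQ _ _ FQx FQy) => ?; [left|right; exists Q].
  move=> [Fx|[Q CQ Qx]] [Fy|[Q' CQ' Qy]].
  - by left; apply: filF.2.
  - by apply: (step Q') => //; [left|right].
  - by apply: (step Q) => //; [right|left].
  - have [QQ'|Q'Q] := totC _ _ CQ CQ'.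
    + by apply: (step Q') => //; right => //; apply: QQ'.
    + by apply: (step Q) => //; right => //; apply: Q'Q.
set M := (F `|` P)%classic in upP capP Pt.
(* By maximality, the filter [N] generated by [M] and [x] must contain [t]. *)
have extend x : ~ M x -> exists2 p, M p & p `&` x <= t.
  move=> Mx; apply: contrapT => noext.
  pose N := [set z | exists2 p, M p & (p `&` x <= z)%O]%classic.
  have MN : (M `<=` N)%classic by move=> z Mz; exists z => //; exact: leIl.
  have NF : (F `|` N = N)%classic.
    by apply/setUidPr => z Fz; apply: MN; left.
  apply: (maxP N).
    split=> [z Pz|/(_ x) NP]; first by apply: MN; right.
    (* Nonemptiness of [F] enters here: [f] witnesses that [x] itself lies in [N]. *)
    by apply: Mx; right; apply: NP; exists f; [left|exact: leIr].
  rewrite NF; split=> //; split.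
    move=> y z leyz [p Mp ley].
    by exists p => //; exact: le_trans leyz.
  move=> y z [p Mp ley] [q Mq lez]; exists (p `&` q); first exact: capP.
  rewrite lexI; apply/andP; split.
    by apply: le_trans ley; rewrite leI2 ?leIl.
  by apply: le_trans lez; rewrite leI2 ?leIr.
exists M; split=> //; last by move=> z Fz; left.
split=> // x y Mxy; apply: contrapT => /not_orP.
move=> [/extend[p Mp lep] /extend[q Mq leq]].
(* By distributivity this meet is a join of two elements below [t], so [M] would contain [t]. *)
apply: Pt; apply: (upP ((x `|` y) `&` (p `&` q))).
  rewrite distrL leUx; apply/andP; split.
    by apply: le_trans lep; rewrite meetC leI2 ?leIl.
  by apply: le_trans leq; rewrite meetC leI2 ?leIr.
exact: (capP _ _ Mxy (capP _ _ Mp Mq)).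
Qed.

End PrimeFilters.

(** * Images of homomorphisms as sub-universes *)

Section HomImage.
Context {d d' : Order.disp_t} {U : universeType d} {U' : universeType d'}.

(** Carrying [homf] in the term lets the sub-universe structure be inferred from it. *)
Definition hom_image (f : U -> U') (homf : universe_hom f) : {pred U'} :=
  fun y => `[< exists x, f x = y >].

Context (f : U -> U') (homf : universe_hom f).

Lemma hom_imageP y : reflect (exists x, f x = y) (y \in hom_image homf).
Proof. exact: asboolP. Qed.

Fact hom_image_meet :
  {in hom_image homf &, forall x y, x `&` y \in hom_image homf}.
Proof.
move=> _ _ /hom_imageP[x <-] /hom_imageP[y <-]; apply/hom_imageP.
by exists (x `&` y); case: homf.
Qed.

Fact hom_image_join :
  {in hom_image homf &, forall x y, x `|` y \in hom_image homf}.
Proof.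
move=> _ _ /hom_imageP[x <-] /hom_imageP[y <-]; apply/hom_imageP.
by exists (x `|` y); case: homf.
Qed.

Fact hom_image_star y : y \in hom_image homf -> star y \in hom_image homf.
Proof.
by move=> /hom_imageP[x <-]; apply/hom_imageP; exists (star x); case: homf.
Qed.

HB.instance Definition _ :=
  Order.isMeetLatticeClosed.Build d' U' (hom_image homf) hom_image_meet.
HB.instance Definition _ :=
  Order.isJoinLatticeClosed.Build d' U' (hom_image homf) hom_image_join.
HB.instance Definition _ :=
  isStarClosed.Build d' U' (hom_image homf) hom_image_star.

Lemma isomorphic_hom_image : injective f ->
  isomorphic_universes U (subuniverse_sort (hom_image homf : subUniverse U')).
Proof.
move=> injf.
have imf x : f x \in hom_image homf by apply/hom_imageP; exists x.
pose h x : subuniverse_sort (hom_image homf : subUniverse U') :=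
  SubUniverseElt (imf x).
have [fstar fU fI] := homf.
have homh : universe_hom h.
  by split=> [x|x y|x y]; apply: val_inj => /=.
have surjh y : exists x, h x = y.
  by have /hom_imageP[x fx] := subuniverse_valP y; exists x; apply: val_inj.
have [g hg] := choice surjh.
have injh : injective h by move=> x y /(congr1 val)/injf.
exists h; split=> //; exists g; split=> // [x|]; first exact: injh.
have [hstar hU hI] := homh.
by split=> [x|x y|x y]; apply: injh; rewrite ?hstar ?hU ?hI !hg.
Qed.

End HomImage.

(** * Necessity: properties of set separations, reflected by embeddings *)

Lemma setsep_distributive V : distributive_universe (setsep V).
Proof.
move=> x y z; apply: setsep_eqP => /=; [exact: setIUl|exact: setUIl].
Qed.

Lemma setsep_scrupulous V : scrupulous (setsep V).
Proof.
(* Smallness of (A, B) gives A ⊆ B, hence B = A ∪ B = V. *)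
have small_rside (s : setsep V) : small s -> rside s = [set: V]%classic.
  by move=> /setsep_leP[/= le_s _]; rewrite -(setsep_cover s) (setUidPr _ _).2.
move=> r s /small_rside Vr /small_rside Vs.
by apply/setsep_leP => /=; rewrite Vr Vs; split; exact: subsetT.
Qed.

Section Embedding.
Context {d d' : Order.disp_t} {U : universeType d} {U' : universeType d'}.
Context (f : U -> U') (homf : universe_hom f) (injf : injective f).

Lemma hom_le x y : (f x <= f y) = (x <= y).
Proof.
by case: homf => _ _ fI; rewrite !leEmeet -fI (inj_eq injf).
Qed.

Lemma hom_distributive : distributive_universe U' -> distributive_universe U.
Proof.
by case: homf => _ fU fI distrU' x y z; apply: injf; rewrite !(fI, fU) distrU'.
Qed.

Lemma hom_scrupulous : scrupulous U' -> scrupulous U.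
Proof.
case: homf => fstar _ _ scrU' r s.
by rewrite /small -!hom_le !fstar; exact: scrU'.
Qed.

End Embedding.

Lemma subuniverse_val_hom {d : Order.disp_t} {U : universeType d}
  (S : subUniverse U) : universe_hom (@subuniverse_val d U S).
Proof. by []. Qed.

(** * Sufficiency: the representation on prime filters *)

Section SpectralImplementation.
Context {d : Order.disp_t} {U : universeType d}.

Definition spectrum :=
  {P : set U | prime_filter P /\ forall s, P s \/ P (star s)}.

Definition spectral_side (s : U) : set spectrum := [set P | sval P s]%classic.

Fact spectral_cover s :
  (spectral_side s `|` spectral_side (star s))%classic =
    [set: spectrum]%classic.
Proof. by apply/seteqP; split=> // P _; exact: (svalP P).2. Qed.

Definition spectral_sep s : setsep spectrum := SetSep (spectral_cover s).

Lemma spectral_sideI x y :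
  spectral_side (x `&` y) = (spectral_side x `&` spectral_side y)%classic.
Proof. by apply/funext => P; exact: (prime_filterI _ _ (svalP P).1). Qed.

Lemma spectral_sideU x y :
  spectral_side (x `|` y) = (spectral_side x `|` spectral_side y)%classic.
Proof. by apply/funext => P; exact: (prime_filterU _ _ (svalP P).1). Qed.

Lemma spectral_sep_hom : universe_hom spectral_sep.
Proof.
split=> [x|x y|x y]; apply: setsep_eqP => //=.
- by rewrite starK.
- by rewrite spectral_sideU.
- by rewrite starU spectral_sideI.
- by rewrite spectral_sideI.
- by rewrite starI spectral_sideU.
Qed.

Context (distrU : distributive_universe U) (scrU : scrupulous U).

(** Otherwise the filter generated by [s] and the co-small elements avoids [t], and a prime filter
    extending it without [t] is a point violating the inclusion. *)
Lemma spectrum_separates s t : (spectral_side s `<=` spectral_side t)%classic ->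
  exists2 r, small r & s `&` star r <= t.
Proof.
move=> sub_st; apply: contrapT => no_r.
pose F := [set z | exists2 r, small r & (s `&` star r <= z)%O]%classic.
have [||P [primeP FP Pt]] :=
  prime_filter_theorem distrU (F := F) (t := t) _ _ no_r.
- split=> [y z leyz [r sr ley]|y z [r sr ley] [q sq lez]].
    by exists r => //; exact: le_trans leyz.
  exists (r `|` q); first exact: small_join.
  rewrite starU lexI; apply/andP; split.
    by apply: le_trans ley; rewrite leI2 ?leIl.
  by apply: le_trans lez; rewrite leI2 ?leIr.
- by exists s, (s `&` star s); [exact: small_meet_star|exact: leIl].
(* The join of [x] and [star x] is co-small, being the star of a small element, so it lies in
   [F]. *)
have coverP x : P x \/ P (star x).
  rewrite -prime_filterU //; apply: FP; exists (x `&` star x).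
    exact: small_meet_star.
  by rewrite starI starK joinC; exact: leIr.
apply: Pt; apply: (sub_st (exist _ P (conj primeP coverP))).
apply: FP; exists (s `&` star s); first exact: small_meet_star.
exact: leIl.
Qed.

Lemma spectral_sep_inj : injective spectral_sep.
Proof.
suff reflect_le s t : spectral_sep s <= spectral_sep t -> s <= t.
  by move=> s t eq_st; apply/le_anti; rewrite !reflect_le ?eq_st.
move=> /setsep_leP[/= /spectrum_separates[r sr le1]].
move=> /spectrum_separates[q sq]; rewrite -starU le_star2 => le2.
(* Here [le2] says that [s] is below the join of [t] and [q]; the part of [s] below [q] is below
   [star r], so [le1] applies. *)
rewrite -(meet_idPr le2) distrU leUx leIl /=.
apply: le_trans le1; rewrite meetC leI2 //.
exact: scrU.
Qed.

End SpectralImplementation.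

Theorem theorem3p6 (d : Order.disp_t) (U : universeType d) :
  strongly_implementable U <-> distributive_universe U /\ scrupulous U.
Proof.
split=> [[V [S [f [homf [g [fK _ _]]]]]]|[distrU scrU]].
  have injf := can_inj fK.
  have injval := @val_inj _ _ (subuniverse_sort S).
  have homval := subuniverse_val_hom S.
  split.
    apply: (hom_distributive homf injf).
    apply: (hom_distributive homval injval).
    exact: setsep_distributive.
  apply: (hom_scrupulous homf injf); apply: (hom_scrupulous homval injval).
  exact: setsep_scrupulous.
exists (@spectrum d U), (hom_image (@spectral_sep_hom d U) : subUniverse _).
exact: isomorphic_hom_image (spectral_sep_inj distrU scrU).
Qed.
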